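(* The link polynomials $\nabla$ (Alexander-Conway), $V$ (Jones) and $D$, regarded as families of Laurent polynomials in $\mathbb{C}[s,s^{-1}]$ indexed by isotopy classes of oriented links, are algebraically independent over $\mathbb{C}[s,s^{-1}]$: if $\Phi\in\mathbb{C}[s,s^{-1}][T_1,T_2,T_3]$ satisfies $\Phi(\nabla(L),V(L),D(L))=0$ for every oriented link $L$, then $\Phi=0$.
   Context: All three are oriented link invariants with values in $\mathbb{C}[s,s^{-1}]$, normalized to take the value $1$ on the unknot and determined by the following skein relations, valid whenever $L_+,L_-,L_0$ are oriented diagrams identical except near one crossing, where $L_+$ has a positive crossing, $L_-$ a negative crossing and $L_0$ the oriented smoothing: $\nabla(L_-)-(s^{-1}-s)\nabla(L_0)-\nabla(L_+)=0$; $s^{-2}V(L_-)-(s-s^{-1})V(L_0)-s^{2}V(L_+)=0$ (the usual Jones polynomial with $t=s^{-2}$, $t^{1/2}=s^{-1}$); $sD(L_+)+s^{-1}D(L_-)-2D(L_0)=0$. *)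

(* Defs.v *)
From HB Require Import structures.
From mathcomp Require Import all_boot all_order all_algebra.
From mathcomp Require Import fraction complex mpoly.
From mathcomp Require Import boolp classical_sets reals.

Set Implicit Arguments.
Unset Strict Implicit.
Unset Printing Implicit Defensive.

Import Order.TTheory GRing.Theory Num.Theory.
Local Open Scope ring_scope.

Local Notation "x %:F" := (tofrac x) : ring_scope.

(** * Laurent polynomials: F[s, s^-1] as a subring of F(s) *)

Definition is_laurent (F : fieldType) : {pred {fraction {poly F}}} :=
  fun x => `[< exists (p : {poly F}) (n : nat), x = p%:F / ('X^n)%:F >].
Arguments is_laurent F : clear implicits.

Lemma tofracXn_neq0 (F : fieldType) n : ('X^n : {poly F})%:F != 0.
Proof. by rewrite tofrac_eq0 monic_neq0 // monicXn. Qed.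

Lemma is_laurent_subring (F : fieldType) : subring_closed (is_laurent F).
Proof.
split.
- by apply/asboolP; exists 1, 0; rewrite expr0 tofrac1 divr1.
- move=> x y /asboolP[p [n ->]] /asboolP[q [m ->]]; apply/asboolP.
  exists (p * 'X^m - q * 'X^n), (n + m)%N.
  rewrite exprD tofracB !tofracM -mulNr addf_div ?tofracXn_neq0 //.
  by rewrite mulNr.
- move=> x y /asboolP[p [n ->]] /asboolP[q [m ->]]; apply/asboolP.
  by exists (p * q), (n + m)%N; rewrite exprD !tofracM mulf_div.
Qed.

HB.instance Definition _ (F : fieldType) :=
  GRing.isSubringClosed.Build _ (is_laurent F) (is_laurent_subring F).

Record laurent (F : fieldType) := Laurent {
  laurent_val : {fraction {poly F}};
  laurent_valP : laurent_val \in is_laurent F }.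

HB.instance Definition _ (F : fieldType) := [isSub for @laurent_val F].
HB.instance Definition _ (F : fieldType) := [Choice of laurent F by <:].
HB.instance Definition _ (F : fieldType) :=
  [SubChoice_isSubComNzRing of laurent F by <:].

Section LaurentUnits.
Variable F : fieldType.
Implicit Types x y : laurent F.

Definition laurent_unit : {pred laurent F} :=
  fun x => (val x != 0) && ((val x)^-1 \in is_laurent F).

Definition laurent_inv x : laurent F := insubd x (val x)^-1.

Lemma laurent_mulVx : {in laurent_unit, left_inverse 1 laurent_inv *%R}.
Proof.
move=> x /andP[x0 xV]; apply: val_inj.
by rewrite rmorphM rmorph1 /= val_insubd xV mulVf.
Qed.

Lemma laurent_unitPl x y : y * x = 1 -> laurent_unit x.
Proof.
move=> /(congr1 val); rewrite rmorphM rmorph1 /= => yx.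
have x0 : val x != 0.
  by apply: contra_eq_neq yx => ->; rewrite mulr0 eq_sym oner_neq0.
rewrite /laurent_unit; have <- : val y = (val x)^-1 by rewrite -[LHS](mulfK x0) yx mul1r.
by apply/andP; split; last exact: valP.
Qed.

Lemma laurent_inv_out : {in [predC laurent_unit], laurent_inv =1 id}.
Proof.
move=> x; rewrite inE -topredE /= /laurent_unit => xV; apply: val_inj.
rewrite val_insubd; case: ifP => // xL; move: xV.
by rewrite xL andbT negbK => /eqP ->; rewrite invr0.
Qed.

HB.instance Definition _ := GRing.ComNzRing_hasMulInverse.Build (laurent F)
  laurent_mulVx laurent_unitPl laurent_inv_out.

Lemma laurent_mulf_eq0 : GRing.integral_domain_axiom (laurent F).
Proof.
move=> x y /(congr1 val); rewrite rmorphM rmorph0 /= => /eqP.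
by rewrite mulf_eq0.
Qed.

HB.instance Definition _ :=
  GRing.ComUnitRing_isIntegral.Build (laurent F) laurent_mulf_eq0.

Lemma laurent_polyP (p : {poly F}) : p%:F \in is_laurent F.
Proof. by apply/asboolP; exists p, 0; rewrite expr0 tofrac1 divr1. Qed.

Definition laurent_s : laurent F := Laurent (laurent_polyP 'X).

Lemma laurent_s_unit : laurent_s \is a GRing.unit.
Proof.
have X0 : ('X : {poly F})%:F != 0 by rewrite tofrac_eq0 polyX_eq0.
rewrite unfold_in /= /laurent_unit /= X0 /=.
by apply/asboolP; exists 1, 1; rewrite expr1 tofrac1 div1r.
Qed.

End LaurentUnits.
Arguments laurent_s F : clear implicits.

(** * Oriented links in R^3

   A (tame) oriented link is a nonempty oriented closed polygon, possibly with
   several components, given by the list of its oriented edges (p, q), from p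
   to q.  The order of the list carries no information. *)

Notation point R := ('rV[R]_3).
Notation edge R := (point R * point R)%type.

Section Links.
Variable R : realType.
Local Open Scope classical_set_scope.
Implicit Types (p q r x : point R) (e : edge R) (E : seq (edge R)).

Definition segment p q : set (point R) :=
  [set x | exists2 t : R, 0 <= t <= 1 & x = (1 - t) *: p + t *: q].

Definition triangle p q r : set (point R) :=
  [set x | exists t u v : R, [/\ 0 <= t, 0 <= u, 0 <= v, t + u + v = 1
                               & x = t *: p + u *: q + v *: r]].

(* The second and third clauses say that every vertex has exactly one incoming
   and exactly one outgoing edge; the last one excludes self-intersections. *)
Definition is_link E : Prop :=
  [/\ E != [::],
      uniq [seq e.1 | e <- E],
      perm_eq [seq e.1 | e <- E] [seq e.2 | e <- E],
      {in E, forall e, e.1 != e.2}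
    & {in E &, forall e e', e != e' ->
        forall x, segment e.1 e.2 x -> segment e'.1 e'.2 x ->
        (x = e.2 /\ x = e'.1) \/ (x = e.1 /\ x = e'.2)}].

Record link := Link { edges :> seq (edge R); linkP : is_link edges }.
Implicit Types (L : link).

(* Reidemeister's elementary move: one edge of L is replaced by the other two
   sides of a triangle that meets the rest of L only at the ends of that edge.
   The triangle may be degenerate, with r inside the edge pq. *)
Definition delta_move L L' : Prop :=
  exists p q r E,
    [/\ perm_eq L ((p, q) :: E),
        perm_eq L' [:: (p, r), (r, q) & E]
      & {in E, forall e, triangle p q r `&` segment e.1 e.2
                         `<=` [set p; q]}].

Inductive isotopic : link -> link -> Prop :=
| isotopic_perm L L' : perm_eq L L' -> isotopic L L'
| isotopic_delta L L' : delta_move L L' -> isotopic L L'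
| isotopic_sym L L' : isotopic L L' -> isotopic L' L
| isotopic_trans L L' L'' :
    isotopic L L' -> isotopic L' L'' -> isotopic L L''.

Definition unknot L : Prop :=
  exists L' p q r, isotopic L L' /\ perm_eq L' [:: (p, q); (q, r); (r, p)].

(** ** Skein triples

   Diagrams are orthogonal projections to the first two coordinates, seen from
   above, i.e. from the positive side of the third axis. *)

Definition cx p : R := p 0 (inord 0).
Definition cy p : R := p 0 (inord 1).
Definition cz p : R := p 0 (inord 2).

Definition above p q : Prop := cx p = cx q /\ cy p = cy q.

(* Points lying above or below the convex hull of the projections of a, b, c
   and d. *)
Definition hull_cylinder a b c d : set (point R) :=
  [set x | exists t u v w : R,
    [/\ [/\ 0 <= t, 0 <= u, 0 <= v & 0 <= w], t + u + v + w = 1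
      & above x (t *: a + u *: b + v *: c + w *: d)]].

(* Near the crossing, a, b, c, d are the corners of a convex quadrilateral in
   the projection, listed counterclockwise; its diagonals ac and bd cross, and
   the remaining edges E avoid the cylinder over the quadrilateral, except at
   the corners.  The strand from a to c is straight, with the point x over the
   crossing; the strand from b to d bends at a point vertically below x in Lp
   and vertically above x in Lm.  Hence the crossing of Lp has the strand
   a -> c over b -> d, and it is positive.  The oriented smoothing L0 joins a
   to d and b to c.

        d   c          d   c          d   c
         \ /            \ /           |   |
          /              \            |   |
         / \            / \           |   |
        a   b          a   b          a   b
         Lp             Lm             L0          *)
Definition skein_triple (Lp Lm L0 : link) : Prop :=
  exists a b c d x lo hi E,
    [/\ [/\ perm_eq Lp [:: (a, c), (b, lo), (lo, d) & E],
            perm_eq Lm [:: (a, c), (b, hi), (hi, d) & E]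
          & perm_eq L0 [:: (a, d), (b, c) & E]],
        0 < cx (c - a) * cy (d - b) - cy (c - a) * cx (d - b),
        (exists2 t : R, 0 < t < 1 & x = (1 - t) *: a + t *: c) /\
        (exists2 t : R, 0 < t < 1 & above x ((1 - t) *: b + t *: d)),
        [/\ above lo x, above hi x, cz lo < cz x & cz x < cz hi]
      & {in E, forall e, hull_cylinder a b c d `&` segment e.1 e.2
                         `<=` [set a; b; c; d]}].

(** * The three invariants *)

Definition link_invariant (A : Type) (f : link -> A) : Prop :=
  forall L L' : link, isotopic L L' -> f L = f L'.

Definition Cs : idomainType := laurent R[i].
Definition s : Cs := laurent_s R[i].

Definition normalized (f : link -> Cs) : Prop := forall U, unknot U -> f U = 1.

Definition alexander_conway (nabla : link -> Cs) : Prop :=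
  [/\ link_invariant nabla, normalized nabla
    & forall Lp Lm L0, skein_triple Lp Lm L0 ->
      nabla Lm - (s^-1 - s) * nabla L0 - nabla Lp = 0].

Definition jones (V : link -> Cs) : Prop :=
  [/\ link_invariant V, normalized V
    & forall Lp Lm L0, skein_triple Lp Lm L0 ->
      s ^- 2 * V Lm - (s - s^-1) * V L0 - s ^+ 2 * V Lp = 0].

Definition D_invariant (D : link -> Cs) : Prop :=
  [/\ link_invariant D, normalized D
    & forall Lp Lm L0, skein_triple Lp Lm L0 ->
      s * D Lp + s^-1 * D Lm - 2 * D L0 = 0].

End Links.

(* Main.v *)
From HB Require Import structures.
From mathcomp Require Import all_boot all_order all_algebra.
From mathcomp Require Import fraction complex mpoly.
From mathcomp Require Import boolp classical_sets reals.
From mathcomp Require Import ring lra zify.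
Require Import Defs.

(* Tie a small meridian circle around a strand of a link L.  Changing one of
   the two new crossings frees the circle, and smoothing it leaves L with a
   curl; smoothing the crossing of a curl in L splits off a free circle.  The
   skein relations therefore multiply (nabla, V, D) by the values on the Hopf
   link: s^-1 (s^2 - 1), - s^-5 (s^4 + 1) and s^-3 (3 s^2 - 1) / 2.  Iterating
   from the unknot gives links with values (a^k, b^k, c^k) for all k.  The three
   factors have pairwise distinct roots, so distinct monomials in a, b, c are
   distinct, and a Vandermonde argument kills every coefficient of Phi. *)

Set Implicit Arguments.
Unset Strict Implicit.
Unset Printing Implicit Defensive.

Import Order.TTheory GRing.Theory Num.Theory.
Local Open Scope ring_scope.
Local Open Scope classical_set_scope.

(** * Polygonal links *)

(** A curl may be inserted in a strand with a crossing of either sign, so in its skein triple both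
    $L_+$ and $L_-$ are isotopic to $L$; the relation then determines the value of $L$ with a free
    circle added, and the clasp triple gives the Hopf factor from it. The obstacle is that isotopies
    are chains of triangle moves on polygons, and that a skein triple restricts a whole vertical
    cylinder. All points are therefore given numerical coordinates in an affine frame, where each
    incidence condition is linear in the barycentric parameters and decided by linear arithmetic.
    For the iteration, the invariant reserves a vertical prism beside one edge of the link, which
    the rest of the link may touch only at the ends of that edge. The sides of its base other than
    [pq] lie on the lines [pb] and [qe], so that the circle just fits. The roots separating the
    three factors are $1$, a primitive eighth root of unity and $1/\sqrt3$. *)

Lemma mem_segment1 (R : realType) (p q : point R) : segment p q p.
Proof. by exists 0; rewrite ?lexx ?ler01 // subr0 scale1r scale0r addr0. Qed.

Lemma mem_segment2 (R : realType) (p q : point R) : segment p q q.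
Proof. by exists 1; rewrite ?lexx ?ler01 // subrr scale0r scale1r add0r. Qed.

Lemma segment_sym (R : realType) (p q x : point R) :
  segment p q x -> segment q p x.
Proof.
move=> [t /andP[t0 t1] ->]; exists (1 - t); last by rewrite subKr addrC.
by rewrite subr_ge0 t1 lerBlDr lerDl.
Qed.

Lemma segment_triangle1 (R : realType) (p q r x : point R) :
  segment p r x -> triangle p q r x.
Proof.
move=> [t /andP[t0 t1] ->]; exists (1 - t), 0, t; split; rewrite ?subr_ge0 //.
- by rewrite addr0 subrK.
- by rewrite scale0r addr0.
Qed.

Lemma segment_triangle2 (R : realType) (p q r x : point R) :
  segment r q x -> triangle p q r x.
Proof.
move=> [t /andP[t0 t1] ->]; exists 0, t, (1 - t); split; rewrite ?subr_ge0 //.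
- by rewrite add0r addrC subrK.
- by rewrite scale0r add0r addrC.
Qed.


Lemma is_link_perm (R : realType) (A B : seq (edge R)) :
  perm_eq A B -> is_link A -> is_link B.
Proof.
move=> AB [A0 Au Ap Ae Ai]; have mAB := perm_mem AB; split.
- by rewrite -size_eq0 -(perm_size AB) size_eq0.
- by rewrite -(perm_uniq (perm_map fst AB)).
- by rewrite -(permPl (perm_map fst AB)) -(permPr (perm_map snd AB)).
- by move=> e; rewrite -mAB; apply: Ae.
- by move=> e e'; rewrite -!mAB; apply: Ai.
Qed.

(** The sides [pr] and [rq] lie in the triangle, so they can meet an old edge only at [p] or [q];
    there the old edge also meets [pq], and the disjointness clause for [(p, q)] tells which of its
    ends it is. The condition on [pr] and [rq] excludes folding back but allows [r] inside [pq]. *)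
Lemma is_link_insert (R : realType) (p q r : point R) (E : seq (edge R)) :
  is_link ((p, q) :: E) -> r != p -> r != q ->
  (forall x, segment p r x -> segment r q x -> x = r) ->
  {in E, forall e, triangle p q r `&` segment e.1 e.2 `<=` [set p; q]} ->
  is_link [:: (p, r), (r, q) & E].
Proof.
move=> [_ /= /andP[pE uE] perm_pq neqE disjE] rp rq prq trE.
have pq : p != q by exact: (neqE (p, q) (mem_head _ _)).
have rE e x : e \in E -> segment e.1 e.2 x -> x <> r.
  move=> eE ex xr; subst x; case: (trE e eE r) => [|/= r_|/= r_].
  - by split=> //; exact/segment_triangle1/mem_segment2.
  - by rewrite r_ eqxx in rp.
  - by rewrite r_ eqxx in rq.
have nqpr : ~ segment p r q.
  by move=> h; move/eqP: rq; apply; rewrite (prq q h (mem_segment2 _ _)).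
have nprq : ~ segment r q p.
  by move=> h; move/eqP: rp; apply; rewrite (prq p (mem_segment1 _ _) h).
have mE e : e \in E -> e \in (p, q) :: E by rewrite inE orbC => ->.
have neE e : e \in E -> (p, q) != e.
  by move=> eE; apply: contraNneq pE => pqe; rewrite -[p]/((p, q).1) pqe map_f.
have disj1 e x : e \in E -> segment p r x -> segment e.1 e.2 x ->
    x = p /\ x = e.2.
  move=> eE px ex; case: (trE e eE x) => [|/= xp|/= xq].
  - by split=> //; exact: segment_triangle1.
  - have := disjE (p, q) e (mem_head _ _) (mE e eE) (neE e eE) x.
    rewrite {1}xp => /(_ (mem_segment1 _ _) ex) [[/= xq _]|//].
    by rewrite -xp xq eqxx in pq.
  - by rewrite xq in px.
have disj2 e x : e \in E -> segment r q x -> segment e.1 e.2 x ->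
    x = q /\ x = e.1.
  move=> eE px ex; case: (trE e eE x) => [|/= xp|/= xq].
  - by split=> //; exact: segment_triangle2.
  - by rewrite xp in px.
  - have := disjE (p, q) e (mem_head _ _) (mE e eE) (neE e eE) x.
    rewrite {1}xq => /(_ (mem_segment2 _ _) ex) [//|[/= xp _]].
    by rewrite -xq xp eqxx in pq.
split=> //=.
- rewrite inE negb_or eq_sym rp pE uE /= andbT; apply/mapP => -[e eE re].
  by apply: (rE e r eE) => //; rewrite re; exact: mem_segment1.
- move: perm_pq => /= /permP h; apply/permP => a; move: (h a) => /=; lia.
- move=> e /predU1P[->|/predU1P[->|eE]] //=; first by rewrite eq_sym.
  exact: neqE (mE e eE).
- move=> e e' /predU1P[->|/predU1P[->|eE]] /predU1P[->|/predU1P[->|eE']] //=;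
    rewrite ?eqxx //= => ee' x ex e'x.
  + by left; split; exact: prq.
  + by right; exact: disj1 ex e'x.
  + by right; split; exact: prq.
  + by left; exact: disj2 ex e'x.
  + by left; have [] := disj1 e x eE e'x ex.
  + by right; have [] := disj2 e x eE e'x ex.
  + by apply: disjE => //; exact: mE.
Qed.

Lemma link_insert (R : realType) (L : link R) (p q r : point R)
    (E : seq (edge R)) :
  perm_eq L ((p, q) :: E) -> r != p -> r != q ->
  (forall x, segment p r x -> segment r q x -> x = r) ->
  {in E, forall e, triangle p q r `&` segment e.1 e.2 `<=` [set p; q]} ->
  exists L' : link R, perm_eq L' [:: (p, r), (r, q) & E] /\ isotopic L L'.
Proof.
move=> LE rp rq prq trE.
have lE := is_link_insert (is_link_perm LE (linkP L)) rp rq prq trE.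
exists (Link lE); split; first exact: perm_refl.
by apply: isotopic_delta; exists p, q, r, E; split.
Qed.

Lemma is_link_cat (R : realType) (A B : seq (edge R)) :
  is_link A -> is_link B ->
  {in A & B, forall e e' x, segment e.1 e.2 x -> ~ segment e'.1 e'.2 x} ->
  is_link (A ++ B).
Proof.
move=> [A0 Au Ap Ae Ai] [_ Bu Bp Be Bi] AB; split.
- by case: (A) A0.
- rewrite map_cat cat_uniq Au Bu andbT; apply/hasPn => _ /mapP[e eB ->].
  apply/negP => /mapP[e' eA' ee'].
  apply: (AB e' e eA' eB e'.1); first exact: mem_segment1.
  by rewrite -ee'; exact: mem_segment1.
- by rewrite !map_cat perm_cat.
- by move=> e; rewrite mem_cat => /orP[/Ae|/Be].
- move=> e e'; rewrite !mem_cat => /orP[eA|eB] /orP[eA'|eB'] ee' x ex e'x.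
  + exact: Ai ex e'x.
  + by case: (AB _ _ eA eB' _ ex).
  + by case: (AB _ _ eA' eB _ e'x).
  + exact: Bi ex e'x.
Qed.

Lemma is_link_triangle (R : realType) (p q r : point R) :
  p != q -> q != r -> r != p ->
  (forall x, segment p q x -> segment q r x -> x = q) ->
  (forall x, segment q r x -> segment r p x -> x = r) ->
  (forall x, segment r p x -> segment p q x -> x = p) ->
  is_link [:: (p, q); (q, r); (r, p)].
Proof.
move=> pq qr rp dq dr dp; split=> //=.
- by rewrite !inE negb_or pq eq_sym rp qr.
- by apply/permP => a /=; lia.
- by move=> e; rewrite !inE => /or3P[] /eqP ->.
- move=> e e'; rewrite !inE => /or3P[] /eqP -> /or3P[] /eqP -> //=;
    rewrite ?eqxx //= => _ x ex e'x.
  + by left; split; exact: dq.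
  + by right; split; exact: dp.
  + by right; split; exact: dq.
  + by left; split; exact: dr.
  + by left; split; exact: dp.
  + by right; split; exact: dr.
Qed.

(** * Frames *)

(* Affine coordinates that preserve verticality, the direction of the vertical
   axis and the orientation of the projection. *)
Record frame (R : realType) := Frame {
  orig : point R; dirx : point R; diry : point R; dirz : point R;
  frame_planar : 0 < cx dirx * cy diry - cy dirx * cx diry;
  frame_vertical : cx dirz = 0 /\ cy dirz = 0;
  frame_up : 0 < cz dirz }.

Definition fpt (R : realType) (f : frame R) (x y z : R) : point R :=
  orig f + x *: dirx f + y *: diry f + z *: dirz f.

Lemma cx_fpt (R : realType) (f : frame R) x y z :
  cx (fpt f x y z) = cx (orig f) + x * cx (dirx f) + y * cx (diry f).
Proof.
have [] := frame_vertical f; rewrite /fpt /cx => w0 _.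
by rewrite !mxE w0; ring.
Qed.

Lemma cy_fpt (R : realType) (f : frame R) x y z :
  cy (fpt f x y z) = cy (orig f) + x * cy (dirx f) + y * cy (diry f).
Proof.
have [] := frame_vertical f; rewrite /fpt /cy => _ w0.
by rewrite !mxE w0; ring.
Qed.

Lemma cz_fpt (R : realType) (f : frame R) x y z :
  cz (fpt f x y z) =
  cz (orig f) + x * cz (dirx f) + y * cz (diry f) + z * cz (dirz f).
Proof. by rewrite /fpt /cz !mxE. Qed.

Lemma point_ext (R : realType) (p q : point R) :
  cx p = cx q -> cy p = cy q -> cz p = cz q -> p = q.
Proof.
move=> ex ey ez; have ordE (k : nat) (ltk : (k < 3)%N) :
    Ordinal ltk = inord k :> 'I_3 by apply/val_inj; rewrite /= inordK.
by apply/rowP => -[[|[|[|//]]] lti]; rewrite ordE.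
Qed.

Lemma above_fpt (R : realType) (f : frame R) x y z x' y' z' :
  above (fpt f x y z) (fpt f x' y' z') -> x = x' /\ y = y'.
Proof.
rewrite /above !cx_fpt !cy_fpt => -[]; have := frame_planar f.
set ux := cx (dirx f); set uy := cy (dirx f).
set vx := cx (diry f); set vy := cy (diry f) => /lt0r_neq0 det0 ex ey.
have ex' : x * ux + y * vx = x' * ux + y' * vx by lra.
have ey' : x * uy + y * vy = x' * uy + y' * vy by lra.
(* Cramer's rule for the planar part of the frame. *)
split; apply: (mulIf det0); apply: subr0_eq.
- transitivity (vy * (x * ux + y * vx - (x' * ux + y' * vx))
              - vx * (x * uy + y * vy - (x' * uy + y' * vy))); first by ring.
  by rewrite ex' ey' !subrr !mulr0 subr0.
- transitivity (ux * (x * uy + y * vy - (x' * uy + y' * vy))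
              - uy * (x * ux + y * vx - (x' * ux + y' * vx))); first by ring.
  by rewrite ex' ey' !subrr !mulr0 subr0.
Qed.

Lemma fpt_inj (R : realType) (f : frame R) x y z x' y' z' :
  fpt f x y z = fpt f x' y' z' -> [/\ x = x', y = y' & z = z'].
Proof.
move=> e; have [xx yy] : x = x' /\ y = y'.
  by apply: (@above_fpt _ f _ _ z _ _ z'); rewrite e.
subst x' y'; split=> //; move/(congr1 (@cz R)): e; rewrite !cz_fpt => /addrI.
by apply: mulIf; exact: lt0r_neq0 (frame_up f).
Qed.

Lemma above_fptP (R : realType) (f : frame R) p x y z :
  above p (fpt f x y z) -> exists z', p = fpt f x y z'.
Proof.
move=> [ex ey]; have w0 := lt0r_neq0 (frame_up f).
exists (z + (cz p - cz (fpt f x y z)) / cz (dirz f)); apply: point_ext.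
- by rewrite ex !cx_fpt.
- by rewrite ey !cy_fpt.
- by rewrite !cz_fpt; field.
Qed.

Lemma fpt_comb4 (R : realType) (f : frame R) (t u v w : R)
    x1 y1 z1 x2 y2 z2 x3 y3 z3 x4 y4 z4 : t + u + v + w = 1 ->
  t *: fpt f x1 y1 z1 + u *: fpt f x2 y2 z2 + v *: fpt f x3 y3 z3
    + w *: fpt f x4 y4 z4 =
  fpt f (t * x1 + u * x2 + v * x3 + w * x4)
        (t * y1 + u * y2 + v * y3 + w * y4)
        (t * z1 + u * z2 + v * z3 + w * z4).
Proof.
move=> sum1; have -> : t = 1 - u - v - w by rewrite -sum1; ring.
by apply/rowP => i; rewrite /fpt !mxE; ring.
Qed.

Lemma fpt_comb3 (R : realType) (f : frame R) (t u v : R)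
    x1 y1 z1 x2 y2 z2 x3 y3 z3 : t + u + v = 1 ->
  t *: fpt f x1 y1 z1 + u *: fpt f x2 y2 z2 + v *: fpt f x3 y3 z3 =
  fpt f (t * x1 + u * x2 + v * x3) (t * y1 + u * y2 + v * y3)
        (t * z1 + u * z2 + v * z3).
Proof.
move=> sum1; have -> : t = 1 - u - v by rewrite -sum1; ring.
by apply/rowP => i; rewrite /fpt !mxE; ring.
Qed.

Lemma fpt_comb2 (R : realType) (f : frame R) (t : R) x1 y1 z1 x2 y2 z2 :
  (1 - t) *: fpt f x1 y1 z1 + t *: fpt f x2 y2 z2 =
  fpt f ((1 - t) * x1 + t * x2) ((1 - t) * y1 + t * y2)
        ((1 - t) * z1 + t * z2).
Proof. by apply/rowP => i; rewrite /fpt !mxE; ring. Qed.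

Lemma segment_fpt (R : realType) (f : frame R) x1 y1 z1 x2 y2 z2 p :
  segment (fpt f x1 y1 z1) (fpt f x2 y2 z2) p ->
  exists2 t, 0 <= t <= 1 & p = fpt f ((1 - t) * x1 + t * x2)
                          ((1 - t) * y1 + t * y2) ((1 - t) * z1 + t * z2).
Proof. by move=> [t t01 ->]; exists t => //; rewrite fpt_comb2. Qed.

Lemma fpt_neq (R : realType) (f : frame R) x y z x' y' z' :
  (x = x' -> y = y' -> z = z' -> False) -> fpt f x y z != fpt f x' y' z'.
Proof. by move=> h; apply/eqP => /fpt_inj[/h{}h /h{}h /h{}h]. Qed.

Lemma segment_meet (R : realType) (f : frame R) x1 y1 z1 x2 y2 z2 x3 y3 z3 :
  (forall t k, 0 <= t <= 1 -> 0 <= k <= 1 ->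
    (1 - t) * x1 + t * x2 = (1 - k) * x2 + k * x3 ->
    (1 - t) * y1 + t * y2 = (1 - k) * y2 + k * y3 ->
    (1 - t) * z1 + t * z2 = (1 - k) * z2 + k * z3 -> k = 0) ->
  forall p, segment (fpt f x1 y1 z1) (fpt f x2 y2 z2) p ->
    segment (fpt f x2 y2 z2) (fpt f x3 y3 z3) p -> p = fpt f x2 y2 z2.
Proof.
move=> h p /segment_fpt[t t01 ->] /segment_fpt[k k01 e].
have [ex ey ez] := fpt_inj e; rewrite e (h t k) // .
by rewrite !mul0r !addr0 !subr0 !mul1r.
Qed.

Lemma segment_disjoint (R : realType) (f : frame R)
    x1 y1 z1 x2 y2 z2 x3 y3 z3 x4 y4 z4 :
  (forall t k, 0 <= t <= 1 -> 0 <= k <= 1 ->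
    (1 - t) * x1 + t * x2 = (1 - k) * x3 + k * x4 ->
    (1 - t) * y1 + t * y2 = (1 - k) * y3 + k * y4 ->
    (1 - t) * z1 + t * z2 = (1 - k) * z3 + k * z4 -> False) ->
  forall p, segment (fpt f x1 y1 z1) (fpt f x2 y2 z2) p ->
    ~ segment (fpt f x3 y3 z3) (fpt f x4 y4 z4) p.
Proof.
move=> h p /segment_fpt[t t01 ->] /segment_fpt[k k01 e].
by have [ex ey ez] := fpt_inj e; exact: (h t k).
Qed.

Lemma triangle_segment (R : realType) (f : frame R)
    x1 y1 z1 x2 y2 z2 x3 y3 z3 x4 y4 z4 x5 y5 z5 :
  (forall t u v k, 0 <= t -> 0 <= u -> 0 <= v -> t + u + v = 1 ->
    0 <= k <= 1 ->
    t * x1 + u * x2 + v * x3 = (1 - k) * x4 + k * x5 ->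
    t * y1 + u * y2 + v * y3 = (1 - k) * y4 + k * y5 ->
    t * z1 + u * z2 + v * z3 = (1 - k) * z4 + k * z5 -> t = 1 \/ u = 1) ->
  triangle (fpt f x1 y1 z1) (fpt f x2 y2 z2) (fpt f x3 y3 z3) `&`
    segment (fpt f x4 y4 z4) (fpt f x5 y5 z5)
  `<=` [set fpt f x1 y1 z1; fpt f x2 y2 z2].
Proof.
move=> h p [[t [u [v [t0 u0 v0 sum1 ->]]]] /segment_fpt[k k01]].
rewrite fpt_comb3 // => e; have [ex ey ez] := fpt_inj e.
have [t1|u1] := h t u v k t0 u0 v0 sum1 k01 ex ey ez; [left|right] => /=.
  have [-> ->] : u = 0 /\ v = 0 by split; lra.
  by rewrite t1 !mul0r !mul1r !addr0.
have [-> ->] : t = 0 /\ v = 0 by split; lra.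
by rewrite u1 !mul0r !mul1r !addr0 !add0r.
Qed.

(* The triangle with vertices (0, 0), (8, 0) and (24/11, -96/11), which contains
   the projections of all the points used below. *)
Definition region (R : realType) (x y : R) : bool :=
  [&& y <= 0, 0 <= 4 * x + y & 3 * x - 2 * y <= 24].

(* Apart from the edge joining (0, 0, 0) to (8, 0, 0), the link stays away from
   the vertical prism over the region, so it can be modified there freely. *)
Definition slot_free (R : realType) (f : frame R) (E : seq (edge R)) : Prop :=
  {in E, forall e x y z, region x y -> segment e.1 e.2 (fpt f x y z) ->
    [/\ x = 0, y = 0 & z = 0] \/ [/\ x = 8, y = 0 & z = 0]}.

Lemma region_comb4 (R : realType) (t u v w x1 y1 x2 y2 x3 y3 x4 y4 : R) :
  0 <= t -> 0 <= u -> 0 <= v -> 0 <= w -> t + u + v + w = 1 ->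
  region x1 y1 -> region x2 y2 -> region x3 y3 -> region x4 y4 ->
  region (t * x1 + u * x2 + v * x3 + w * x4)
         (t * y1 + u * y2 + v * y3 + w * y4).
Proof.
move=> t0 u0 v0 w0 sum1.
(* The only nonlinear step: once each inequality is multiplied by its weight, the products count as
   atoms for [lra]. *)
have scale (k x y : R) : 0 <= k -> region x y ->
    [/\ k * y <= 0, 0 <= 4 * (k * x) + k * y
      & 3 * (k * x) - 2 * (k * y) <= 24 * k].
  move=> k0 /and3P[a b c]; split; first by rewrite mulr_ge0_le0.
  - by rewrite mulrCA -mulrDr mulr_ge0.
  - by rewrite mulrCA [2 * _]mulrCA -mulrBr [24 * k]mulrC ler_wpM2l.
move=> /(scale _ _ _ t0)[a1 b1 c1] /(scale _ _ _ u0)[a2 b2 c2].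
move=> /(scale _ _ _ v0)[a3 b3 c3] /(scale _ _ _ w0)[a4 b4 c4].
by apply/and3P; split; lra.
Qed.

Lemma region_comb3 (R : realType) (t u v x1 y1 x2 y2 x3 y3 : R) :
  0 <= t -> 0 <= u -> 0 <= v -> t + u + v = 1 ->
  region x1 y1 -> region x2 y2 -> region x3 y3 ->
  region (t * x1 + u * x2 + v * x3) (t * y1 + u * y2 + v * y3).
Proof.
move=> t0 u0 v0 sum1 r1 r2 r3.
have := @region_comb4 R t u v 0 x1 y1 x2 y2 x3 y3 x3 y3 t0 u0 v0 (lexx _).
by rewrite !mul0r !addr0; apply.
Qed.

(** Edges of [E] can reach the prism only at [(0, 0, 0)] and [(8, 0, 0)], so the triangle has to be
    tested at these two points alone. *)
Lemma triangle_slot (R : realType) (f : frame R) E x1 y1 z1 x2 y2 z2 x3 y3 z3 :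
  slot_free f E -> region x1 y1 -> region x2 y2 -> region x3 y3 ->
  (forall t u v, 0 <= t -> 0 <= u -> 0 <= v -> t + u + v = 1 ->
    t * x1 + u * x2 + v * x3 = 0 \/ t * x1 + u * x2 + v * x3 = 8 ->
    t * y1 + u * y2 + v * y3 = 0 -> t * z1 + u * z2 + v * z3 = 0 ->
    t = 1 \/ u = 1) ->
  {in E, forall e,
    triangle (fpt f x1 y1 z1) (fpt f x2 y2 z2) (fpt f x3 y3 z3) `&`
    segment e.1 e.2 `<=` [set fpt f x1 y1 z1; fpt f x2 y2 z2]}.
Proof.
move=> fE r1 r2 r3 h e eE p [[t [u [v [t0 u0 v0 sum1 ->]]]]].
rewrite fpt_comb3 // => ep.
have r := region_comb3 t0 u0 v0 sum1 r1 r2 r3.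
have [] : t = 1 \/ u = 1.
- by case: (fE e eE _ _ _ r ep) => -[ex ey ez]; apply: (h t u v) => //;
    [left|right].
- move=> t1; left => /=; have [-> ->] : u = 0 /\ v = 0 by split; lra.
  by rewrite t1 !mul0r !mul1r !addr0.
- move=> u1; right => /=; have [-> ->] : t = 0 /\ v = 0 by split; lra.
  by rewrite u1 !mul0r !mul1r !addr0 !add0r.
Qed.

(** The elementary move behind all isotopies below: the explicit nearby edges [T] are checked one by
    one, the unknown rest [E] through the slot. *)
Lemma frame_insert (R : realType) (f : frame R) (L : link R)
    (T E : seq (edge R)) (x1 y1 z1 x2 y2 z2 x3 y3 z3 : R) :
  perm_eq L ((fpt f x1 y1 z1, fpt f x2 y2 z2) :: T ++ E) ->
  slot_free f E -> region x1 y1 -> region x2 y2 -> region x3 y3 ->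
  (x3 = x1 -> y3 = y1 -> z3 = z1 -> False) ->
  (x3 = x2 -> y3 = y2 -> z3 = z2 -> False) ->
  (forall t k, 0 <= t <= 1 -> 0 <= k <= 1 ->
    (1 - t) * x1 + t * x3 = (1 - k) * x3 + k * x2 ->
    (1 - t) * y1 + t * y3 = (1 - k) * y3 + k * y2 ->
    (1 - t) * z1 + t * z3 = (1 - k) * z3 + k * z2 -> k = 0) ->
  (forall t u v, 0 <= t -> 0 <= u -> 0 <= v -> t + u + v = 1 ->
    t * x1 + u * x2 + v * x3 = 0 \/ t * x1 + u * x2 + v * x3 = 8 ->
    t * y1 + u * y2 + v * y3 = 0 -> t * z1 + u * z2 + v * z3 = 0 ->
    t = 1 \/ u = 1) ->
  {in T, forall e,
    triangle (fpt f x1 y1 z1) (fpt f x2 y2 z2) (fpt f x3 y3 z3) `&`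
    segment e.1 e.2 `<=` [set fpt f x1 y1 z1; fpt f x2 y2 z2]} ->
  exists L' : link R,
    perm_eq L' [:: (fpt f x1 y1 z1, fpt f x3 y3 z3),
                   (fpt f x3 y3 z3, fpt f x2 y2 z2) & T ++ E]
    /\ isotopic L L'.
Proof.
move=> LE fE r1 r2 r3 n1 n2 m c tT; apply: link_insert LE _ _ _ _.
- exact: fpt_neq.
- exact: fpt_neq.
- exact: segment_meet.
- move=> e; rewrite mem_cat => /orP[/tT//|eE].
  exact: triangle_slot eE.
Qed.

Lemma hull_cylinder_fpt (R : realType) (f : frame R)
    x1 y1 z1 x2 y2 z2 x3 y3 z3 x4 y4 z4 x y z :
  hull_cylinder (fpt f x1 y1 z1) (fpt f x2 y2 z2) (fpt f x3 y3 z3)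
    (fpt f x4 y4 z4) (fpt f x y z) ->
  exists t u v w, [/\ [/\ 0 <= t, 0 <= u, 0 <= v & 0 <= w], t + u + v + w = 1,
    x = t * x1 + u * x2 + v * x3 + w * x4
    & y = t * y1 + u * y2 + v * y3 + w * y4].
Proof.
move=> [t [u [v [w [pos sum1]]]]]; rewrite fpt_comb4 // => /above_fpt[ex ey].
by exists t, u, v, w.
Qed.

Lemma hull_segment_disjoint (R : realType) (f : frame R) (C : set (point R))
    x1 y1 z1 x2 y2 z2 x3 y3 z3 x4 y4 z4 x5 y5 z5 x6 y6 z6 :
  (forall t u v w k, 0 <= t -> 0 <= u -> 0 <= v -> 0 <= w ->
    t + u + v + w = 1 -> 0 <= k <= 1 ->
    (1 - k) * x5 + k * x6 = t * x1 + u * x2 + v * x3 + w * x4 ->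
    (1 - k) * y5 + k * y6 = t * y1 + u * y2 + v * y3 + w * y4 -> False) ->
  hull_cylinder (fpt f x1 y1 z1) (fpt f x2 y2 z2) (fpt f x3 y3 z3)
    (fpt f x4 y4 z4) `&` segment (fpt f x5 y5 z5) (fpt f x6 y6 z6) `<=` C.
Proof.
move=> h p [hp /segment_fpt[k k01 ep]]; move: hp; rewrite ep.
move=> /hull_cylinder_fpt[t [u [v [w [[t0 u0 v0 w0] sum1 ex ey]]]]].
by case: (h t u v w k).
Qed.

Lemma hull_segment_start (R : realType) (f : frame R) (C : set (point R))
    x1 y1 z1 x2 y2 z2 x3 y3 z3 x4 y4 z4 x5 y5 z5 x6 y6 z6 :
  C (fpt f x5 y5 z5) ->
  (forall t u v w k, 0 <= t -> 0 <= u -> 0 <= v -> 0 <= w ->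
    t + u + v + w = 1 -> 0 <= k <= 1 ->
    (1 - k) * x5 + k * x6 = t * x1 + u * x2 + v * x3 + w * x4 ->
    (1 - k) * y5 + k * y6 = t * y1 + u * y2 + v * y3 + w * y4 -> k = 0) ->
  hull_cylinder (fpt f x1 y1 z1) (fpt f x2 y2 z2) (fpt f x3 y3 z3)
    (fpt f x4 y4 z4) `&` segment (fpt f x5 y5 z5) (fpt f x6 y6 z6) `<=` C.
Proof.
move=> C5 h p [hp /segment_fpt[k k01 ep]]; move: hp; rewrite ep.
move=> /hull_cylinder_fpt[t [u [v [w [[t0 u0 v0 w0] sum1 ex ey]]]]].
by rewrite (h t u v w k) // !mul0r !addr0 !subr0 !mul1r.
Qed.

Lemma hull_segment_end (R : realType) (f : frame R) (C : set (point R))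
    x1 y1 z1 x2 y2 z2 x3 y3 z3 x4 y4 z4 x5 y5 z5 x6 y6 z6 :
  C (fpt f x6 y6 z6) ->
  (forall t u v w k, 0 <= t -> 0 <= u -> 0 <= v -> 0 <= w ->
    t + u + v + w = 1 -> 0 <= k <= 1 ->
    (1 - k) * x6 + k * x5 = t * x1 + u * x2 + v * x3 + w * x4 ->
    (1 - k) * y6 + k * y5 = t * y1 + u * y2 + v * y3 + w * y4 -> k = 0) ->
  hull_cylinder (fpt f x1 y1 z1) (fpt f x2 y2 z2) (fpt f x3 y3 z3)
    (fpt f x4 y4 z4) `&` segment (fpt f x5 y5 z5) (fpt f x6 y6 z6) `<=` C.
Proof.
move=> C6 h p [hp /segment_sym sp].
exact: (hull_segment_start C6 h) (conj hp sp).
Qed.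

(** By convexity the quadrilateral stays over the region. Its cylinder is vertically unbounded,
    which is why a slot excludes the rest of the link at every height. *)
Lemma hull_slot (R : realType) (f : frame R) E
    x1 y1 z1 x2 y2 z2 x3 y3 z3 x4 y4 z4 :
  slot_free f E ->
  region x1 y1 -> region x2 y2 -> region x3 y3 -> region x4 y4 ->
  {in E, forall e,
    hull_cylinder (fpt f x1 y1 z1) (fpt f x2 y2 z2) (fpt f x3 y3 z3)
      (fpt f x4 y4 z4) `&` segment e.1 e.2
    `<=` [set fpt f 0 0 0; fpt f 8 0 0]}.
Proof.
move=> fE r1 r2 r3 r4 e eE p [[t [u [v [w [[t0 u0 v0 w0] sum1]]]]]].
rewrite fpt_comb4 // => ab; have [z ->] := above_fptP ab => ep.
have r := region_comb4 t0 u0 v0 w0 sum1 r1 r2 r3 r4.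
by case: (fE e eE _ _ _ r ep) => -[-> -> ->]; [left|right].
Qed.

Lemma slot_disjoint (R : realType) (f : frame R) E x1 y1 z1 x2 y2 z2 :
  slot_free f E -> region x1 y1 -> region x2 y2 -> y1 < 0 -> y2 < 0 ->
  {in E, forall e p, segment e.1 e.2 p ->
    ~ segment (fpt f x1 y1 z1) (fpt f x2 y2 z2) p}.
Proof.
move=> fE r1 r2 y10 y20 e eE p ep /segment_fpt[t /andP[t0 t1] Ep].
move: ep; rewrite Ep => ep.
have t1' : 0 <= 1 - t by rewrite subr_ge0.
have r : region ((1 - t) * x1 + t * x2) ((1 - t) * y1 + t * y2).
  have := region_comb3 t1' t0 (lexx 0) _ r1 r2 r2.
  by rewrite !mul0r !addr0 subrK; apply.
(* Both exceptional points of the slot have second coordinate [0]. *)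
suff : (1 - t) * y1 + t * y2 < 0.
  by move=> /ltr0_neq0/eqP y0; case: (fE e eE _ _ _ r ep) => -[].
have [->|tn1] := eqVneq t 1; first by rewrite subrr mul0r add0r mul1r.
have : (1 - t) * y1 < 0 by rewrite pmulr_rlt0 // subr_gt0 lt_neqAle tn1.
have : t * y2 <= 0 by rewrite mulr_ge0_le0 // ltW.
lra.
Qed.

(** A frame multiplies planar determinants by its own positive one, so signs of crossings can be
    read off in frame coordinates. *)
Lemma planar_det_fpt (R : realType) (f : frame R)
    x1 y1 z1 x2 y2 z2 x3 y3 z3 x4 y4 z4 :
  0 < (x3 - x1) * (y4 - y2) - (y3 - y1) * (x4 - x2) ->
  0 < cx (fpt f x3 y3 z3 - fpt f x1 y1 z1)
        * cy (fpt f x4 y4 z4 - fpt f x2 y2 z2)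
      - cy (fpt f x3 y3 z3 - fpt f x1 y1 z1)
        * cx (fpt f x4 y4 z4 - fpt f x2 y2 z2).
Proof.
move=> det0; have cxB u v : cx (u - v) = cx u - cx v :> R by rewrite /cx !mxE.
have cyB u v : cy (u - v) = cy u - cy v :> R by rewrite /cy !mxE.
rewrite !cxB !cyB !cx_fpt !cy_fpt.
rewrite [ltRHS](_ : _ = ((x3 - x1) * (y4 - y2) - (y3 - y1) * (x4 - x2)) *
   (cx (dirx f) * cy (diry f) - cy (dirx f) * cx (diry f))); last by ring.
exact: mulr_gt0 det0 (frame_planar f).
Qed.

Lemma above_fpt_eq (R : realType) (f : frame R) x y z x' y' z' :
  x = x' -> y = y' -> above (fpt f x y z) (fpt f x' y' z').
Proof. by move=> -> ->; rewrite /above !cx_fpt !cy_fpt. Qed.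

Lemma cz_fpt_lt (R : realType) (f : frame R) x y z z' :
  z < z' -> cz (fpt f x y z) < cz (fpt f x y z').
Proof. by move=> zz'; rewrite !cz_fpt ltrD2l ltr_pM2r // frame_up. Qed.

(** * Adding a Hopf link *)

Ltac solve_perm :=
  repeat match goal with |- context [fpt ?f ?x ?y ?z] =>
    move: (fpt f x y z) => ? end;
  apply/permP => ?; rewrite /= ?count_cat /=;
  repeat match goal with |- context [nat_of_bool ?b] =>
    move: (nat_of_bool b) => ? end;
  lia.

Ltac solve_linear := clear;
  intros; repeat match goal with
  | H : is_true (_ && _) |- _ => case/andP: H; intros
  | H : _ \/ _ |- _ => destruct H
  end; first [lra | left; lra | right; lra].

Ltac solve_region := by apply/and3P; split; lra.

Ltac solve_triangle :=
  move=> e; rewrite ?inE;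
  repeat (case/predU1P=> [->|]; [apply: triangle_segment; solve_linear|]);
  rewrite ?in_nil //; try (move/eqP ->; apply: triangle_segment; solve_linear).

Ltac solve_insert LE fE :=
  apply: frame_insert fE _ _ _ _ _ _ _ _;
  [by apply: (perm_trans LE); solve_perm
  | solve_region | solve_region | solve_region | solve_linear
  | solve_linear | solve_linear | solve_linear | solve_triangle].

Section HopfSum.
Variables (R : realType) (f : frame R) (E : seq (edge R)).
Hypothesis fE : slot_free f E.

Tactic Notation "insert" ident(L') ident(L'E) ident(iso) ident(LE)
    constr(x) constr(y) constr(z) constr(T) :=
  let LL := match type of LE with is_true (perm_eq (edges ?L) _) => L end in
  have [L' [L'E iso]] : exists L' : link R,
    perm_eq L' [:: (x, z), (z, y) & T ++ E] /\ isotopic LL L';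
  [solve_insert LE fE | ].

(* The link runs along p -> q, or p -> c -> q.  The circle b -> hi -> d -> e at
   height 1 passes above it; with lo instead of hi, it clasps p -> c -> q.  The
   points hi' and lo' lie above and below the crossing of p -> e with d -> q. *)
Local Notation p := (fpt f 0 0 0).
Local Notation q := (fpt f 8 0 0).
Local Notation c := (fpt f 3 (- 6) 0).
Local Notation b := (fpt f 2 (- 8) 1).
Local Notation d := (fpt f 2 (- 3) 1).
Local Notation e := (fpt f 6 (- 3) 1).
Local Notation hi := (fpt f 2 (- 4) 1).
Local Notation lo := (fpt f 2 (- 4) (- 1)).
Local Notation hi' := (fpt f 4 (- 2) 1).
Local Notation lo' := (fpt f 4 (- 2) 0).

(** The new path crosses itself in projection only where [de], at height 1, passes over [cq], which
    is a curl. *)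
Lemma smoothed_hopf_isotopic (L : link R) : perm_eq L ((p, q) :: E) ->
  exists L' : link R, isotopic L L' /\
    perm_eq L' ([:: (p, d); (d, e); (e, b); (b, c); (c, q)] ++ E).
Proof.
move=> LE.
insert L1 L1E iso1 LE p q c ([::] : seq (edge R)).
insert L2 L2E iso2 L1E p c e [:: (c, q)].
insert L3 L3E iso3 L2E p e d [:: (e, c); (c, q)].
insert L4 L4E iso4 L3E e c b [:: (p, d); (d, e); (c, q)].
exists L4; split.
  by do 3 (apply: isotopic_trans; first by eassumption); eassumption.
by apply: (perm_trans L4E); solve_perm.
Qed.

(** The loop through [e], [b], [hi], [d] becomes the free circle once its crossing is smoothed. *)
Lemma kink_under_isotopic (L : link R) : perm_eq L ((p, q) :: E) ->
  exists L' : link R, isotopic L L' /\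
    perm_eq L' ([:: (p, e); (d, lo'); (lo', q); (e, b); (b, hi); (hi, d)] ++ E).
Proof.
move=> LE.
insert L1 L1E iso1 LE p q d ([::] : seq (edge R)).
(* The straight segments [pe] and [dq] meet at height [2 / 3] over [(4, -2)], so [dq] has to be bent
   before [e] is inserted. *)
insert L2 L2E iso2 L1E d q lo' [:: (p, d)].
insert L3 L3E iso3 L2E p d e [:: (d, lo'); (lo', q)].
insert L4 L4E iso4 L3E e d hi [:: (p, e); (d, lo'); (lo', q)].
insert L5 L5E iso5 L4E e hi b [:: (p, e); (hi, d); (d, lo'); (lo', q)].
exists L5; split.
  by do 4 (apply: isotopic_trans; first by eassumption); eassumption.
by apply: (perm_trans L5E); solve_perm.
Qed.

Lemma kink_over_isotopic (L : link R) : perm_eq L ((p, q) :: E) ->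
  exists L' : link R, isotopic L L' /\
    perm_eq L' ([:: (p, e); (d, hi'); (hi', q); (e, b); (b, hi); (hi, d)] ++ E).
Proof.
move=> LE.
insert L1 L1E iso1 LE p q d ([::] : seq (edge R)).
insert L2 L2E iso2 L1E d q hi' [:: (p, d)].
insert L3 L3E iso3 L2E p d e [:: (d, hi'); (hi', q)].
insert L4 L4E iso4 L3E e d hi [:: (p, e); (d, hi'); (hi', q)].
insert L5 L5E iso5 L4E e hi b [:: (p, e); (hi, d); (d, hi'); (hi', q)].
exists L5; split.
  by do 4 (apply: isotopic_trans; first by eassumption); eassumption.
by apply: (perm_trans L5E); solve_perm.
Qed.

(** The triangle [b d e] with a vertex added inside [bd], where a skein triple needs its second
    strand to bend. *)
Lemma circle_over : is_link [:: (b, hi); (hi, d); (d, e); (e, b)].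
Proof.
apply: is_link_insert.
- apply: is_link_triangle; do ?[apply: fpt_neq; solve_linear];
    apply: segment_meet; solve_linear.
- apply: fpt_neq; solve_linear.
- apply: fpt_neq; solve_linear.
- apply: segment_meet; solve_linear.
- solve_triangle.
Qed.

Lemma circle_under : is_link [:: (b, lo); (lo, d); (d, e); (e, b)].
Proof.
apply: is_link_insert.
- apply: is_link_triangle; do ?[apply: fpt_neq; solve_linear];
    apply: segment_meet; solve_linear.
- apply: fpt_neq; solve_linear.
- apply: fpt_neq; solve_linear.
- apply: segment_meet; solve_linear.
- solve_triangle.
Qed.

Lemma split_union (L : link R) : perm_eq L ((p, q) :: E) ->
  exists U : link R,
    perm_eq U ((p, q) :: E ++ [:: (b, hi); (hi, d); (d, e); (e, b)]).
Proof.
move=> LE; rewrite -cat_cons.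
suff lU : is_link (((p, q) :: E) ++ [:: (b, hi); (hi, d); (d, e); (e, b)]).
  by exists (Link lU).
apply: is_link_cat (is_link_perm LE (linkP L)) circle_over _ => s t.
rewrite !inE => /predU1P[->|sE] /or4P[] /eqP -> x.
1-4: by apply: segment_disjoint; solve_linear.
all: by apply: slot_disjoint sE x => //; solve [solve_region | lra].
Qed.

Lemma hopf_union (L : link R) : perm_eq L ((p, q) :: E) ->
  exists H : link R,
    perm_eq H ([:: (p, c); (c, q)] ++ E
                ++ [:: (b, lo); (lo, d); (d, e); (e, b)]).
Proof.
move=> LE; insert L1 L1E iso1 LE p q c ([::] : seq (edge R)).
rewrite catA.
suff lH : is_link (([:: (p, c); (c, q)] ++ E)
    ++ [:: (b, lo); (lo, d); (d, e); (e, b)]) by exists (Link lH).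
apply: is_link_cat (is_link_perm L1E (linkP L1)) circle_under _ => s t.
rewrite !inE => /predU1P[->|/predU1P[->|sE]] /or4P[] /eqP -> x.
1-8: by apply: segment_disjoint; solve_linear.
all: by apply: slot_disjoint sE x => //; solve [solve_region | lra].
Qed.

Lemma split_union_bent (U : link R) :
  perm_eq U ((p, q) :: E ++ [:: (b, hi); (hi, d); (d, e); (e, b)]) ->
  exists U' : link R, isotopic U U' /\
    perm_eq U' ([:: (p, c); (c, q)] ++ E
                 ++ [:: (b, hi); (hi, d); (d, e); (e, b)]).
Proof.
move=> UE.
insert U1 U1E iso1 UE p q c [:: (b, hi); (hi, d); (d, e); (e, b)].
by exists U1; split=> //; apply: (perm_trans U1E); solve_perm.
Qed.

(** Smoothing joins [p] to [q] and [d] to [e], which restores the straight edge and closes the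
    loop. *)
Lemma kink_triple (Kp Km U : link R) :
  perm_eq Kp ([:: (p, e); (d, lo'); (lo', q); (e, b); (b, hi); (hi, d)] ++ E) ->
  perm_eq Km ([:: (p, e); (d, hi'); (hi', q); (e, b); (b, hi); (hi, d)] ++ E) ->
  perm_eq U ((p, q) :: E ++ [:: (b, hi); (hi, d); (d, e); (e, b)]) ->
  skein_triple Kp Km U.
Proof.
move=> KpE KmE UE.
exists p, d, e, q, (fpt f 4 (- 2) (2 / 3)), lo', hi',
  ([:: (e, b); (b, hi); (hi, d)] ++ E).
split.
- split; [exact: KpE|exact: KmE|].
  by apply: (perm_trans UE); solve_perm.
- by apply: planar_det_fpt; lra.
- split; [exists (2 / 3)|exists (1 / 3)]; try (by apply/andP; split; lra).
    by rewrite fpt_comb2; congr fpt; lra.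
  by rewrite fpt_comb2; apply: above_fpt_eq; lra.
- by split; [exact: above_fpt_eq|exact: above_fpt_eq|apply: cz_fpt_lt; lra
            |apply: cz_fpt_lt; lra].
- move=> s; rewrite mem_cat => /orP[|sE].
    rewrite !inE => /or3P[] /eqP ->.
    + by apply: hull_segment_start; [left; right | solve_linear].
    + by apply: hull_segment_disjoint; solve_linear.
    + by apply: hull_segment_end; [left; left; right | solve_linear].
  apply: (subset_trans (hull_slot fE _ _ _ _ sE)); try solve_region.
  by move=> x [->|->]; [do 3 left|right].
Qed.

(** Only the crossing of [pc] with the strand from [b] to [d] changes; at the other one, of [cq]
    with [de], the circle stays on top. So the circle of [Hm] lies entirely above, while that of
    [Hp] is clasped. *)
Lemma hopf_triple (Hp Hm H0 : link R) :
  perm_eq Hp ([:: (p, c); (c, q)] ++ E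
               ++ [:: (b, lo); (lo, d); (d, e); (e, b)]) ->
  perm_eq Hm ([:: (p, c); (c, q)] ++ E
               ++ [:: (b, hi); (hi, d); (d, e); (e, b)]) ->
  perm_eq H0 ([:: (p, d); (d, e); (e, b); (b, c); (c, q)] ++ E) ->
  skein_triple Hp Hm H0.
Proof.
move=> HpE HmE H0E.
exists p, b, c, d, (fpt f 2 (- 4) 0), lo, hi,
  ([:: (c, q); (d, e); (e, b)] ++ E).
split.
- by split; [apply: (perm_trans HpE)|apply: (perm_trans HmE)
            |apply: (perm_trans H0E)]; solve_perm.
- by apply: planar_det_fpt; lra.
- split; [exists (2 / 3)|exists (4 / 5)]; try (by apply/andP; split; lra).
    by rewrite fpt_comb2; congr fpt; lra.
  by rewrite fpt_comb2; apply: above_fpt_eq; lra.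
- by split; [exact: above_fpt_eq|exact: above_fpt_eq|apply: cz_fpt_lt; lra
            |apply: cz_fpt_lt; lra].
- move=> s; rewrite mem_cat => /orP[|sE].
    rewrite !inE => /or3P[] /eqP ->.
    + by apply: hull_segment_start; [left; right | solve_linear].
    + by apply: hull_segment_start; [right | solve_linear].
    + by apply: hull_segment_end; [left; left; right | solve_linear].
  move=> x [hx sx]; have [] := hull_slot fE _ _ _ _ sE (conj hx sx);
    try solve_region.
    by move=> ->; do 3 left.
  (* Here [q] is not a corner, but the quadrilateral has first coordinates at most [3], so [q] is
     not over it. *)
  move=> xq; move: hx; rewrite xq => /hull_cylinder_fpt.
  by move=> [t [u [v [w [[t0 u0 v0 w0] sum1 ex ey]]]]]; exfalso; lra.
Qed.

(* The next slot is a thin triangle along the edge e -> b of the circle, on its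
   inner side. *)
Local Notation dirx' := (- (1 / 2) *: dirx f - (5 / 8) *: diry f).
Local Notation diry' := ((1 / 32) *: dirx f).

Lemma next_frame_planar : 0 < cx dirx' * cy diry' - cy dirx' * cx diry'.
Proof.
have := frame_planar f; rewrite /cx /cy !mxE.
set ux := dirx f _ _; set vy := diry f _ _; set uy := dirx f _ _.
set vx := diry f _ _ => h.
rewrite [ltRHS](_ : _ = (5 / 256) * (ux * vy - uy * vx)); last by field.
by apply: mulr_gt0 h; lra.
Qed.

(** The point [(0, 0, 0)] becomes [e] and [(8, 0, 0)] becomes [b]; the factor [1 / 32] makes the
    slot thin enough to miss the bent strand through [c]. *)
Lemma next_frame : exists f' : frame R, forall x y z,
  fpt f' x y z = fpt f (6 - x / 2 + y / 32) (- 3 - 5 * x / 8) (1 + z).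
Proof.
exists (@Frame _ e dirx' diry' (dirz f)
  next_frame_planar (frame_vertical f) (frame_up f)) => x y z.
by apply/rowP => i; rewrite /fpt /= !mxE; field.
Qed.

Lemma next_slot (f' : frame R) : (forall x y z,
  fpt f' x y z = fpt f (6 - x / 2 + y / 32) (- 3 - 5 * x / 8) (1 + z)) ->
  slot_free f' ([:: (p, c); (c, q); (b, lo); (lo, d); (d, e)] ++ E).
Proof.
move=> f'E s; rewrite mem_cat => /orP[sT|sE] x y z /and3P[r1 r2 r3].
  move: sT; rewrite f'E !inE.
  move=> /or4P[|||/orP[]] /eqP -> /segment_fpt[t /andP[t0 t1]];
    move=> /fpt_inj[ex ey ez].
  - exfalso; lra.
  - exfalso; lra.
  - right; split; lra.
  - exfalso; lra.
  - left; split; lra.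
rewrite f'E => h; exfalso.
(* The new region lies in the part of the old one with second coordinate at most [-3], away from the
   two points that [E] may touch. *)
have r : region (6 - x / 2 + y / 32) (- 3 - 5 * x / 8) by solve_region.
by case: (fE sE r h) => -[_ y0 _]; lra.
Qed.

End HopfSum.

(** * Algebra *)

(** By linearity the powers may be replaced by any polynomial; the product of the ['X - mu j] over
    [j != i] isolates [c i]. *)
Lemma power_sums_eq0 (K : idomainType) (I : eqType) (r : seq I)
    (c mu : I -> K) :
  uniq r -> {in r &, injective mu} ->
  (forall k, \sum_(i <- r) c i * mu i ^+ k = 0) -> {in r, forall i, c i = 0}.
Proof.
move=> ur injmu sum0 i ir.
have horner0 (P : {poly K}) : \sum_(j <- r) c j * P.[mu j] = 0.
  under eq_bigr do rewrite horner_coef mulr_sumr.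
  rewrite exchange_big big1 //= => k _.
  by under eq_bigr do rewrite mulrCA; rewrite -mulr_sumr sum0 mulr0.
have := horner0 (\prod_(j <- rem i r) ('X - (mu j)%:P)).
rewrite (bigD1_seq i) //= [X in _ + X]big_seq_cond [X in _ + X]big1 ?addr0;
  first move=> /eqP; last move=> j /andP[jr ji].
  rewrite mulf_eq0 => /orP[/eqP//|]; rewrite horner_prod prodf_seq_eq0.
  case/hasP => j; rewrite mem_rem_uniq // inE => /andP[ji jr] /=.
  rewrite hornerXsubC subr_eq0 => /eqP muij.
  by rewrite (injmu _ _ ir jr muij) eqxx in ji.
rewrite horner_prod (bigD1_seq j) ?rem_uniq //= ?mem_rem_uniq ?inE ?ji //.
by rewrite hornerXsubC subrr mul0r mulr0.
Qed.

(** At the [k]-th powers of [v], each monomial takes the [k]-th power of its value at [v], so the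
    hypothesis is a family of vanishing power sums weighted by the coefficients. *)
Lemma mpoly_eq0_of_powers (K : idomainType) (n : nat) (v : 'I_n -> K)
    (Phi : {mpoly K[n]}) :
  injective (fun m : 'X_{1..n} => \prod_(i < n) v i ^+ m i) ->
  (forall k, Phi.@[fun i => v i ^+ k] = 0) -> Phi = 0.
Proof.
move=> injv Phi0; apply/mpolyP => m; rewrite mcoeff0.
have [mS|/memN_msupp_eq0//] := boolP (m \in msupp Phi).
apply: (@power_sums_eq0 K _ (msupp Phi) (fun m => Phi@_m)
  (fun m => \prod_(i < n) v i ^+ m i)) mS => //.
- by move=> x y _ _; exact: injv.
- move=> k; rewrite -[RHS](Phi0 k) mevalE; apply: eq_bigr => j _.
  congr (_ * _); rewrite -prodrXl; apply: eq_bigr => i _.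
  by rewrite -!exprM mulnC.
Qed.

(** If the exponents differed, cancelling the smaller power of [A] would leave one side vanishing at
    [r] and the other not. *)
Lemma eq_root_multiplicity (F : fieldType) (A G G' : {poly F}) (r : F) k k' :
  A != 0 -> root A r -> ~~ root G r -> ~~ root G' r ->
  A ^+ k * G = A ^+ k' * G' -> k = k'.
Proof.
wlog le_kk' : G G' k k' / (k <= k')%N => [hw A0 rA rG rG' e|A0 rA rG rG'].
  have [le_kk'|/ltnW le_k'k] := leqP k k'.
    exact: hw le_kk' A0 rA rG rG' e.
  exact/esym/(hw _ _ _ _ le_k'k A0 rA rG' rG (esym e)).
rewrite -(subnKC le_kk') exprD -mulrA => /(mulfI (expf_neq0 _ A0)) GG'.
case: (k' - k)%N GG' => [|j] GG'; first by rewrite addn0.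
by move: rG; rewrite GG' exprS -mulrA rootM rA.
Qed.

(** Here [n], [u], [n'] are the values of the link, of its split union with a circle, and of its
    Hopf sum. The first relation is that of the curl and forces [u = 0]; the second is that of the
    clasp. *)
Lemma conway_step (K : idomainType) (x n u n' : K) :
  x \is a GRing.unit -> x ^+ 2 - 1 != 0 ->
  n - (x^-1 - x) * u - n = 0 -> u - (x^-1 - x) * n - n' = 0 ->
  n' = x^-1 * (x ^+ 2 - 1) * n.
Proof.
move=> /divrr; set i := x^-1 => xi x0 eK eH.
have u0 : u = 0.
  apply: (mulfI x0); rewrite mulr0 -[RHS](mulr0 x) -eK.
  by ring: xi.
by rewrite u0 in eH; rewrite -[LHS]addr0 -eH; ring: xi.
Qed.

(** The curl gives the usual Jones factor [- (x + x^-1)] of a free circle, after division by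
    [x - x^-1]. *)
Lemma jones_step (K : idomainType) (x n u n' : K) :
  x \is a GRing.unit -> x ^+ 2 - 1 != 0 ->
  x ^- 2 * n - (x - x^-1) * u - x ^+ 2 * n = 0 ->
  x ^- 2 * u - (x - x^-1) * n - x ^+ 2 * n' = 0 ->
  n' = x^-1 ^+ 5 * - (x ^+ 4 + 1) * n.
Proof.
move=> /divrr; rewrite -exprVn; set i := x^-1 => xi x0 eK eH.
have uE : u = - (x + i) * n.
  apply: (mulfI x0); apply: subr0_eq; rewrite -[RHS](mulr0 (- x)) -eK.
  by ring: xi.
rewrite uE in eH; apply: subr0_eq; rewrite -[RHS](mulr0 (- i ^+ 2)) -eH.
by ring: xi.
Qed.

Lemma D_step (K : idomainType) (x h n u n' : K) :
  x \is a GRing.unit -> h * 2 = 1 ->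
  x * n + x^-1 * n - 2 * u = 0 -> x * n' + x^-1 * u - 2 * n = 0 ->
  n' = x^-1 ^+ 3 * (h * (3 * x ^+ 2 - 1)) * n.
Proof.
move=> /divrr; set i := x^-1 => xi h2 eK eH.
have uE : u = h * (x + i) * n.
  by apply: subr0_eq; rewrite -[RHS](mulr0 (- h)) -eK; ring: h2.
(* This gives every term in [n] the factor [h], so that [x * x^-1 = 1] is the only relation left to
   use. *)
have nE : 2 * n = 2 * (h * 2 * n) by rewrite h2 mul1r.
rewrite uE nE in eH.
by apply: subr0_eq; rewrite -[RHS](mulr0 i) -eH; ring: xi.
Qed.

Section LaurentPolynomials.
Variable F : fieldType.

Definition laurent_of_poly (p : {poly F}) : laurent F :=
  Laurent (laurent_polyP p).

Lemma laurent_of_polyM p q :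
  laurent_of_poly (p * q) = laurent_of_poly p * laurent_of_poly q.
Proof. by apply: val_inj; rewrite rmorphM /= tofracM. Qed.

Lemma laurent_of_polyB p q :
  laurent_of_poly (p - q) = laurent_of_poly p - laurent_of_poly q.
Proof. by apply: val_inj; rewrite rmorphB /= tofracB. Qed.

Lemma laurent_of_poly1 : laurent_of_poly 1 = 1.
Proof. by apply: val_inj; rewrite rmorph1 /= tofrac1. Qed.

HB.instance Definition _ := GRing.isZmodMorphism.Build _ _ laurent_of_poly
  laurent_of_polyB.
HB.instance Definition _ := GRing.isMonoidMorphism.Build _ _ laurent_of_poly
  (conj laurent_of_poly1 laurent_of_polyM).

Lemma laurent_of_poly_inj : injective laurent_of_poly.
Proof.
by move=> p q /(congr1 val) /= /eqP; rewrite tofrac_eq => /eqP.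
Qed.

End LaurentPolynomials.

Section HopfValues.
Variable C : numClosedFieldType.
Local Notation S := (laurent_s C).

Definition laurent_half : laurent C := laurent_of_poly (2^-1)%:P.

Lemma laurent_half_mul2 : laurent_half * 2 = 1.
Proof.
rewrite -[2](rmorph_nat (@laurent_of_poly C) 2) -rmorphM /=.
by rewrite -polyC_natr -polyCM mulVf ?pnatr_eq0 ?rmorph1.
Qed.

Definition hopf_nabla : {poly C} := 'X^2 - 1.
Definition hopf_jones : {poly C} := - ('X^4 + 1).
Definition hopf_D : {poly C} := (2^-1)%:P * ('X^2 *+ 3 - 1).

Definition hopf_value : 'I_3 -> laurent C :=
  tnth [tuple S^-1 * laurent_of_poly hopf_nabla;
    (S^-1) ^+ 5 * laurent_of_poly hopf_jones;
    (S^-1) ^+ 3 * laurent_of_poly hopf_D].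

Lemma laurent_sE : S = laurent_of_poly 'X. Proof. by apply: val_inj. Qed.

Lemma laurent_sV : S * S^-1 = 1. Proof. by rewrite divrr // laurent_s_unit. Qed.

Lemma laurent_s2_neq1 : S ^+ 2 - 1 != 0.
Proof.
rewrite laurent_sE -(rmorphXn (@laurent_of_poly C)).
rewrite -(rmorph1 (@laurent_of_poly C)).
rewrite -rmorphB; apply/eqP => /(congr1 val) /= /eqP.
by rewrite tofrac_eq0 -size_poly_eq0 size_XnsubC.
Qed.

Lemma hopf_nablaE : laurent_of_poly hopf_nabla = S ^+ 2 - 1.
Proof. by rewrite rmorphB rmorphXn rmorph1 /= -laurent_sE. Qed.

Lemma hopf_jonesE : laurent_of_poly hopf_jones = - (S ^+ 4 + 1).
Proof. by rewrite rmorphN rmorphD rmorphXn rmorph1 /= -laurent_sE. Qed.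

Lemma hopf_DE : laurent_of_poly hopf_D = laurent_half * (3 * S ^+ 2 - 1).
Proof.
by rewrite rmorphM rmorphB rmorphMn rmorphXn rmorph1 /= -laurent_sE mulr_natl.
Qed.

(** The power of [S] clears the denominators [S], [S ^+ 5] and [S ^+ 3] of the three Hopf values. *)
Lemma hopf_monomial (m : 'X_{1..3}) :
  S ^+ (m ord0 + 5 * m (lift ord0 ord0) + 3 * m ord_max)
    * (\prod_(i < 3) hopf_value i ^+ m i) =
  laurent_of_poly (hopf_nabla ^+ m ord0 * hopf_jones ^+ m (lift ord0 ord0)
                   * hopf_D ^+ m ord_max).
Proof.
have -> : \prod_(i < 3) hopf_value i ^+ m i =
  (S^-1 * laurent_of_poly hopf_nabla) ^+ m ord0 *
  ((S^-1) ^+ 5 * laurent_of_poly hopf_jones) ^+ m (lift ord0 ord0) *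
  ((S^-1) ^+ 3 * laurent_of_poly hopf_D) ^+ m ord_max.
  rewrite !big_ord_recl big_ord0 mulr1 mulrA.
  by congr (_ * _ ^+ m _); apply/val_inj.
have scaled k j (P : laurent C) : S ^+ (k * j) * (S^-1 ^+ k * P) ^+ j = P ^+ j.
  by rewrite exprM -exprMn mulrA -exprMn laurent_sV expr1n mul1r.
rewrite (rmorphM (@laurent_of_poly C) (hopf_nabla ^+ _ * _)).
rewrite (rmorphM _ (hopf_nabla ^+ _)) 3!(rmorphXn (@laurent_of_poly C)).
rewrite -(scaled 1%N _ (laurent_of_poly hopf_nabla)).
rewrite -(scaled 5%N _ (laurent_of_poly hopf_jones)).
rewrite -(scaled 3%N _ (laurent_of_poly hopf_D)) mul1n expr1.
by rewrite 2!exprD mulrACA [X in X * _ = _]mulrACA.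
Qed.

Lemma hopf_value_injective :
  injective (fun m : 'X_{1..3} => \prod_(i < 3) hopf_value i ^+ m i).
Proof.
move=> m m' /= e.
(* Both clearing powers multiply the equation, so the one of [m'] remains on the side of [m]. These
   powers of ['X] do no harm, since the roots used below are nonzero. *)
have {e} : 'X^(m' ord0 + 5 * m' (lift ord0 ord0) + 3 * m' ord_max) *
   (hopf_nabla ^+ m ord0 * hopf_jones ^+ m (lift ord0 ord0)
    * hopf_D ^+ m ord_max)
  = 'X^(m ord0 + 5 * m (lift ord0 ord0) + 3 * m ord_max) *
   (hopf_nabla ^+ m' ord0 * hopf_jones ^+ m' (lift ord0 ord0)
    * hopf_D ^+ m' ord_max).
  apply: laurent_of_poly_inj; rewrite !(rmorphM _ 'X^_) !rmorphXn /=.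
  rewrite -laurent_sE.
  by rewrite -!hopf_monomial e mulrCA.
set n := (X in 'X^X); set n' := (X in _ = 'X^X * _).
set a := m _; set b := m _; set c := m _.
set a' := m' _; set b' := m' _; set c' := m' _ => e.
have nA r : hopf_nabla.[r] = r ^+ 2 - 1 by rewrite /hopf_nabla !hornerE.
have nB r : hopf_jones.[r] = - ((r ^+ 2) ^+ 2 + 1).
  by rewrite /hopf_jones !hornerE -exprM mulnE.
have nC r : hopf_D.[r] = 2^-1 * (r ^+ 2 *+ 3 - 1).
  by rewrite /hopf_D hornerM hornerC hornerD hornerN hornerMn hornerXn hornerC.
have two0 : (2 : C) != 0 by rewrite pnatr_eq0.
have neq0 (P : {poly C}) r : P.[r] != 0 -> P != 0.
  by apply: contra_neq => ->; rewrite horner0.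
have A0 : hopf_nabla != 0.
  by apply: (neq0 _ 0); rewrite nA expr0n sub0r oppr_eq0 oner_eq0.
have B0 : hopf_jones != 0.
  by apply: (neq0 _ 0); rewrite nB !expr0n add0r oppr_eq0 oner_eq0.
have C0 : hopf_D != 0.
  by apply: (neq0 _ 0); rewrite nC expr0n mul0rn sub0r mulrN1 oppr_eq0 invr_eq0.
have nroot (P Q : {poly C}) r k i j : r != 0 -> P.[r] != 0 -> Q.[r] != 0 ->
    ~~ root ('X^k * P ^+ i * Q ^+ j) r.
  move=> r0 P0 Q0; rewrite rootE 2!hornerM hornerXn 2!horner_exp.
  by rewrite !mulf_neq0 ?expf_neq0.
have swap1 (x u v w : {poly C}) : u * (x * v * w) = x * (u * v * w) by ring.
have swap2 (x u v w : {poly C}) : v * (x * u * w) = x * (u * v * w) by ring.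
have swap3 (x u v w : {poly C}) : w * (x * u * v) = x * (u * v * w) by ring.
have ea : a = a'.
  apply: (@eq_root_multiplicity _ hopf_nabla
    ('X^n * hopf_jones ^+ b * hopf_D ^+ c)
    ('X^n' * hopf_jones ^+ b' * hopf_D ^+ c') 1) => //.
  - by rewrite rootE nA expr1n subrr.
  - apply: nroot; rewrite ?oner_neq0 // ?nB ?nC !expr1n.
      by rewrite oppr_eq0.
    by rewrite mulf_neq0 ?invr_eq0 // mulrS addrAC subrr add0r.
  - apply: nroot; rewrite ?oner_neq0 // ?nB ?nC !expr1n.
      by rewrite oppr_eq0.
    by rewrite mulf_neq0 ?invr_eq0 // mulrS addrAC subrr add0r.
  - exact: etrans (swap1 _ _ _ _) (etrans e (esym (swap1 _ _ _ _))).
have eb : b = b'.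
  pose z : C := sqrtC (sqrtC (- 1)).
  have z2 : z ^+ 2 = sqrtC (- 1) by rewrite sqrtCK.
  have z4 : (z ^+ 2) ^+ 2 = - 1 by rewrite z2 sqrtCK.
  have z0 : z != 0.
    by apply: contra_eq_neq z4 => ->; rewrite !expr0n eq_sym oppr_eq0 oner_eq0.
  have Az : hopf_nabla.[z] != 0.
    rewrite nA subr_eq0; apply: contra_eq_neq z4 => ->.
    by rewrite expr1n -subr_eq0 opprK.
  have Cz : hopf_D.[z] != 0.
    (* Squaring $3z^2=1$ would give $-9=1$. *)
    rewrite nC mulf_neq0 ?invr_eq0 // subr_eq0; apply/eqP => z3.
    have : (z ^+ 2 *+ 3) ^+ 2 = 1 by rewrite z3 expr1n.
    rewrite exprMn_n z4 mulNrn => /eqP.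
    by rewrite eq_sym -subr_eq0 opprK -mulrS pnatr_eq0.
  apply: (@eq_root_multiplicity _ hopf_jones
    ('X^n * hopf_nabla ^+ a * hopf_D ^+ c)
    ('X^n' * hopf_nabla ^+ a' * hopf_D ^+ c') z) => //.
  - by rewrite rootE nB z4 addNr oppr0.
  - exact: nroot.
  - exact: nroot.
  - exact: etrans (swap2 _ _ _ _) (etrans e (esym (swap2 _ _ _ _))).
have ec : c = c'.
  pose w : C := sqrtC (3^-1).
  have w2 : w ^+ 2 = 3^-1 by rewrite sqrtCK.
  have three0 : (3 : C) != 0 by rewrite pnatr_eq0.
  have w0 : w != 0.
    by apply: contra_eq_neq w2 => ->; rewrite expr0n eq_sym invr_eq0.
  have Aw : hopf_nabla.[w] != 0.
    by rewrite nA w2 subr_eq0 invr_eq1 (eqr_nat _ 3 1).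
  have Bw : hopf_jones.[w] != 0.
    by rewrite nB w2 oppr_eq0 gt_eqF // ltr_wpDl ?exprn_ge0 ?invr_ge0 ?ler0n.
  apply: (@eq_root_multiplicity _ hopf_D
    ('X^n * hopf_nabla ^+ a * hopf_jones ^+ b)
    ('X^n' * hopf_nabla ^+ a' * hopf_jones ^+ b') w) => //.
  - by rewrite rootE nC w2 -[_ *+ 3]mulr_natr mulVf ?pnatr_eq0 // subrr mulr0.
  - exact: nroot.
  - exact: nroot.
  - exact: etrans (swap3 _ _ _ _) (etrans e (esym (swap3 _ _ _ _))).
apply/mnmP => j; case: (unliftP ord0 j) => [j1|] ->; last exact: ea.
case: (unliftP ord0 j1) => [j2|] ->; last exact: eb.
rewrite (ord1 j2); move: ec; rewrite /c /c'.
by congr (m _ = m' _); apply/val_inj.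
Qed.

End HopfValues.

(** * The invariants of iterated Hopf sums *)

(* L' is the connected sum of L with a Hopf link. *)
Definition hopf_related (R : realType) (L L' : link R) : Prop :=
  exists Kp Km U Hm H0 : link R,
    [/\ skein_triple Kp Km U, isotopic L Kp & isotopic L Km] /\
    [/\ skein_triple L' Hm H0, isotopic U Hm & isotopic L H0].

(** The new slot lies on the edge [eb] of the added circle, so iteration from the unknot produces
    chains of circles. *)
Lemma hopf_sum (R : realType) (f : frame R) (E : seq (edge R)) (L : link R) :
  slot_free f E -> perm_eq L ((fpt f 0 0 0, fpt f 8 0 0) :: E) ->
  exists (f' : frame R) (E' : seq (edge R)) (L' : link R),
    [/\ slot_free f' E', perm_eq L' ((fpt f' 0 0 0, fpt f' 8 0 0) :: E')
      & hopf_related L L'].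
Proof.
move=> fE LE; have [f' f'E] := next_frame f.
have [Kp [LKp KpE]] := kink_under_isotopic fE LE.
have [Km [LKm KmE]] := kink_over_isotopic fE LE.
have [U UE] := split_union fE LE.
have [Hm [UHm HmE]] := split_union_bent fE UE.
have [H0 [LH0 H0E]] := smoothed_hopf_isotopic fE LE.
have [L' L'E] := hopf_union fE LE.
have fE' := next_slot fE f'E.
exists f'; eexists; exists L'; split; first exact: fE'.
  apply: (perm_trans L'E); rewrite !f'E.
  have -> : fpt f (6 - 0 / 2 + 0 / 32) (-3 - 5 * 0 / 8) (1 + 0) =
    fpt f 6 (- 3) 1 by congr fpt; lra.
  have -> : fpt f (6 - 8 / 2 + 0 / 32) (-3 - 5 * 8 / 8) (1 + 0) =
    fpt f 2 (- 8) 1 by congr fpt; lra.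
  by solve_perm.
exists Kp, Km, U, Hm, H0; split; split=> //.
  exact: kink_triple KpE KmE UE.
exact: hopf_triple L'E HmE H0E.
Qed.

Lemma frame_inhabited (R : realType) : inhabited (frame R).
Proof.
pose ei k : point R := \row_j (j == inord k)%:R.
have eiE k l : (k < 3)%N -> (l < 3)%N -> ei k 0 (inord l) = (l == k)%:R.
  by move=> k3 l3; rewrite mxE -val_eqE /= !inordK.
have planar : 0 < cx (ei 0) * cy (ei 1) - cy (ei 0) * cx (ei 1).
  by rewrite /cx /cy !eiE // mulr1 mulr0 subr0 ltr01.
have vertical : cx (ei 2) = 0 /\ cy (ei 2) = 0 by rewrite /cx /cy !eiE.
have up : 0 < cz (ei 2) by rewrite /cz eiE // ltr01.
exact: inhabits (Frame 0 planar vertical up).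
Qed.

(** The third vertex [(0, 8, 0)] puts the triangle on the side of its edge opposite to the
    region. *)
Lemma unknot_slot (R : realType) :
  exists (f : frame R) (E : seq (edge R)) (L : link R),
    [/\ slot_free f E, perm_eq L ((fpt f 0 0 0, fpt f 8 0 0) :: E)
      & unknot L].
Proof.
have [f] := frame_inhabited R.
pose p := fpt f 0 0 0; pose q := fpt f 8 0 0; pose r := fpt f 0 8 0.
have lpqr : is_link [:: (p, q); (q, r); (r, p)].
  by apply: is_link_triangle; rewrite /p /q /r;
    do ?[apply: fpt_neq; solve_linear];
    apply: segment_meet; solve_linear.
exists f, [:: (q, r); (r, p)], (Link lpqr); split=> //; last first.
  by exists (Link lpqr), p, q, r; split=> //; apply: isotopic_perm.
move=> s sE x y z /and3P[r1 r2 r3]; move: sE; rewrite !inE /p /q /r.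
by move=> /orP[] /eqP -> /segment_fpt[t /andP[t0 t1]] /fpt_inj[ex ey ez];
  [right|left]; split; lra.
Qed.

Lemma hopf_related_values (R : realType) (nabla V D : link R -> Cs R)
    (L L' : link R) :
  alexander_conway nabla -> jones V -> D_invariant D -> hopf_related L L' ->
  forall j : 'I_3, tnth [tuple nabla L'; V L'; D L'] j =
    hopf_value R[i] j * tnth [tuple nabla L; V L; D L] j.
Proof.
move=> [nI _ nS] [VI _ VS] [DI _ DS].
move=> [Kp [Km [U [Hm [H0 [[skK LKp LKm] [skH UHm LH0]]]]]]].
have := nS _ _ _ skH; have := nS _ _ _ skK.
have := VS _ _ _ skH; have := VS _ _ _ skK.
have := DS _ _ _ skH; have := DS _ _ _ skK.
(* Isotopy replaces [Kp], [Km], [H0] by [L] and [Hm] by [U], leaving two equations per invariant in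
   its values at [L], [U], [L']. *)
rewrite -!(nI _ _ LKp, nI _ _ LKm, nI _ _ UHm, nI _ _ LH0).
rewrite -!(VI _ _ LKp, VI _ _ LKm, VI _ _ UHm, VI _ _ LH0).
rewrite -!(DI _ _ LKp, DI _ _ LKm, DI _ _ UHm, DI _ _ LH0).
move=> DK DH VK VH nK nH j.
have su := laurent_s_unit R[i]; have s2 := laurent_s2_neq1 R[i].
case: (unliftP ord0 j) => [j1|] ->; last first.
  rewrite /hopf_value !(tnth_nth 0) /= hopf_nablaE.
  exact: (conway_step su s2 nK nH).
case: (unliftP ord0 j1) => [j2|] ->; last first.
  rewrite /hopf_value !(tnth_nth 0) /= hopf_jonesE.
  exact: (jones_step su s2 VK VH).
rewrite (ord1 j2) /hopf_value !(tnth_nth 0) /= hopf_DE.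
exact: (D_step su (laurent_half_mul2 _) DK DH).
Qed.

Lemma hopf_sum_iter (R : realType) (nabla V D : link R -> Cs R) (k : nat) :
  alexander_conway nabla -> jones V -> D_invariant D ->
  exists (f : frame R) (E : seq (edge R)) (L : link R),
    [/\ slot_free f E, perm_eq L ((fpt f 0 0 0, fpt f 8 0 0) :: E)
      & forall j : 'I_3,
          tnth [tuple nabla L; V L; D L] j = hopf_value R[i] j ^+ k].
Proof.
move=> hn hV hD; elim: k => [|k [f [E [L [fE LE Lk]]]]].
  have [f [E [L [fE LE uL]]]] := unknot_slot R; exists f, E, L; split=> // j.
  have [[_ n1 _] [_ V1 _] [_ D1 _]] := And3 hn hV hD.
  rewrite n1 // V1 // D1 //.
  by rewrite expr0; case: (unliftP ord0 j) => [j1|] -> //;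
    case: (unliftP ord0 j1) => [j2|] -> //; rewrite (ord1 j2).
have [f' [E' [L' [fE' LE' LL']]]] := hopf_sum fE LE.
exists f', E', L'; split=> // j.
by rewrite (hopf_related_values hn hV hD LL') Lk exprS.
Qed.

Theorem theorem1p12 (R : realType) (nabla V D : link R -> Cs R)
    (hnabla : alexander_conway nabla) (hV : jones V) (hD : D_invariant D)
    (Phi : {mpoly (Cs R)[3]})
    (hPhi : forall L : link R,
       Phi.@[tnth [tuple nabla L; V L; D L]] = 0) :
  Phi = 0.
Proof.
apply: (mpoly_eq0_of_powers (@hopf_value_injective R[i])) => k.
have [_ [_ [L [_ _ Lk]]]] := hopf_sum_iter k hnabla hV hD.
by rewrite -[RHS](hPhi L); apply: meval_eq => j; rewrite Lk.
Qed.
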